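(* Let $m\ge 1$ and $n\ge 2$ be integers, let $P_m$ be the path of length $m$ (with $m+1$ vertices) and let $K_n$ be the complete graph on $n$ vertices. The sparing number of the corona $P_m\odot K_n$ is $$\varphi(P_m\odot K_n)=\tfrac12 n(n-1)(m+1).$$
   Context: All graphs are simple, finite and without isolated vertices. $\mathbb{N}_0$ is the set of non-negative integers; for finite $A,B\subseteq\mathbb{N}_0$, $A+B=\{a+b: a\in A, b\in B\}$. An integer additive set-indexer (IASI) of a graph $G$ is an injective function $f:V(G)\to\mathcal{P}(\mathbb{N}_0)$, with finite sets as values, such that the induced function $f^+:E(G)\to\mathcal{P}(\mathbb{N}_0)$, $f^+(uv)=f(u)+f(v)$, is also injective. An IASI $f$ is weak if $|f^+(uv)|=\max(|f(u)|,|f(v)|)$ for every edge $uv\in E(G)$. A vertex $v$ (edge $e$) is mono-indexed if $|f(v)|=1$ ($|f^+(e)|=1$). The sparing number $\varphi(G)$ is the minimum, over all weak IASIs of $G$, of the number of mono-indexed edges of $G$. The corona $G_1\odot G_2$ is obtained by taking one copy of $G_1$ and $|V(G_1)|$ copies of $G_2$, and joining the $i$-th vertex of $G_1$ to every vertex of the $i$-th copy of $G_2$. *)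

(* Defs.v *)
From HB Require Import structures.
From mathcomp Require Import all_boot finmap.

Set Implicit Arguments.
Unset Strict Implicit.
Unset Printing Implicit Defensive.

Local Open Scope fset_scope.

Record sgraph := SGraph {
  vertex :> finType;
  adj : rel vertex;
  adj_sym : symmetric adj;
  adj_irrefl : irreflexive adj
}.

Definition sumset (A B : {fset nat}) : {fset nat} :=
  [fset (a + b)%N | a in A, b in B].

(* The value f^+(uv), for adjacent u and v; it does not depend on the order of
   u and v. *)
Definition induced (G : sgraph) (f : G -> {fset nat}) (u v : G) : {fset nat} :=
  sumset (f u) (f v).

(* Edges are unordered pairs, hence injectivity of f^+ on E(G) is expressed by
   equality of the sets of endpoints. The values of f may be empty. *)
Definition iasi (G : sgraph) (f : G -> {fset nat}) : Prop :=
  injective f /\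
  forall u v u' v' : G, adj u v -> adj u' v' ->
    induced f u v = induced f u' v' -> [set u; v] = [set u'; v'].

Definition weak_iasi (G : sgraph) (f : G -> {fset nat}) : Prop :=
  iasi f /\
  forall u v : G, adj u v -> #|` induced f u v| = maxn #|` f u| #|` f v|.

Definition mono_edges (G : sgraph) (f : G -> {fset nat}) : {set {set G}} :=
  [set [set p.1; p.2] | p : G * G & adj p.1 p.2 && (#|` induced f p.1 p.2| == 1)].

(* phi(G) = k: the minimum exists and is k. *)
Definition is_sparing_number (G : sgraph) (k : nat) : Prop :=
  (exists f : G -> {fset nat}, weak_iasi f /\ #|mono_edges f| = k) /\
  (forall f : G -> {fset nat}, weak_iasi f -> k <= #|mono_edges f|).

Section PathGraph.
Variable m : nat.
Definition path_adj : rel 'I_m.+1 :=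
  fun i j => (i.+1 == j :> nat) || (j.+1 == i :> nat).
Lemma path_adj_sym : symmetric path_adj.
Proof. by move=> i j; rewrite /path_adj orbC. Qed.
Lemma path_adj_irrefl : irreflexive path_adj.
Proof. by move=> i; rewrite /path_adj orbb; apply/negbTE; rewrite neq_ltn ltnSn orbT. Qed.
(* m is the length (number of edges), so there are m + 1 vertices. *)
Definition path_graph : sgraph := SGraph path_adj_sym path_adj_irrefl.
End PathGraph.

Section CompleteGraph.
Variable n : nat.
Definition complete_adj : rel 'I_n := fun i j => i != j.
Lemma complete_adj_sym : symmetric complete_adj.
Proof. by move=> i j; rewrite /complete_adj eq_sym. Qed.
Lemma complete_adj_irrefl : irreflexive complete_adj.
Proof. by move=> i; rewrite /complete_adj eqxx. Qed.
Definition complete_graph : sgraph :=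
  SGraph complete_adj_sym complete_adj_irrefl.
End CompleteGraph.

Section Corona.
Variables G1 G2 : sgraph.
(* inl x is the vertex x of G1, and inr (x, y) is the vertex y of the copy of
   G2 attached to x. *)
Definition corona_adj : rel (G1 + G1 * G2)%type := fun a b =>
  match a, b with
  | inl x, inl x' => adj x x'
  | inl x, inr q => x == q.1
  | inr p, inl x => x == p.1
  | inr p, inr q => (p.1 == q.1) && adj p.2 q.2
  end.
Lemma corona_adj_sym : symmetric corona_adj.
Proof.
by move=> [x|p] [y|q] //=; rewrite adj_sym // eq_sym.
Qed.
Lemma corona_adj_irrefl : irreflexive corona_adj.
Proof. by move=> [x|p] /=; rewrite adj_irrefl ?andbF. Qed.
Definition corona : sgraph := SGraph corona_adj_sym corona_adj_irrefl.
End Corona.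

(* Main.v *)
(** In a weak IASI every vertex with a neighbour has a nonempty label, and for
    nonempty [A], [B] the equality [#|A + B| = max #|A| #|B|] forces [A] or [B]
    to be a singleton; so the vertices with non-singleton labels are pairwise
    nonadjacent.  Each vertex [x] of [G], together with its copy of [K_n], spans
    a complete graph on [n + 1] vertices, hence contains at most one such vertex
    and at least ['C(n, 2)] mono-indexed edges.  When [G] is 2-coloured, the bound
    is attained by giving doubletons to the vertices of one colour and, for every
    vertex of the other colour, to one vertex of its copy of [K_n]: then no edge
    of [G] is mono-indexed.  Labels built on distinct powers of 2 make [f] and
    [f^+] injective. *)
Require Import Defs.
From mathcomp Require Import all_boot finmap zify.

Set Implicit Arguments.
Unset Strict Implicit.
Unset Printing Implicit Defensive.

(** * Cardinalities of sumsets of finite sets of naturals *)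

Lemma sumsetP (A B : {fset nat}) (x : nat) :
  reflect (exists2 a, a \in A & exists2 b, b \in B & x = a + b)
          (x \in sumset A B).
Proof.
apply: (iffP (imfset2P _ _ _ _ _)) => -[a aA [b bB ->]];
  by exists a => //; exists b.
Qed.

Lemma sumsetC (A B : {fset nat}) : sumset A B = sumset B A.
Proof.
apply/fsetP => x; apply/sumsetP/sumsetP => -[a aA [b bB ->]];
  by exists b => //; exists a; rewrite // addnC.
Qed.

Lemma sumset0 (A : {fset nat}) : sumset A fset0 = fset0.
Proof.
apply/fsetP => x; rewrite in_fset0.
by apply/negbTE/sumsetP => -[a _ [b]]; rewrite in_fset0.
Qed.

Lemma sumset1 (a : nat) (B : {fset nat}) :
  sumset [fset a]%fset B = [fset (a + b)%N | b in B]%fset.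
Proof.
apply/fsetP => x; apply/sumsetP/imfsetP => /=.
  by case=> c /fset1P -> [b bB ->]; exists b.
by case=> b bB ->; exists a; [rewrite fset11 | exists b].
Qed.

Lemma card_sumset1 (a : nat) (B : {fset nat}) :
  #|` sumset [fset a]%fset B| = #|` B|.
Proof. by rewrite sumset1 card_imfset //=; apply: addnI. Qed.

Lemma sumsetS (A A' B : {fset nat}) :
  (A `<=` A' -> sumset A B `<=` sumset A' B)%fset.
Proof.
move=> /fsubsetP sAA'; apply/fsubsetP => x /sumsetP[a aA [b bB ->]].
by apply/sumsetP; exists a; [apply: sAA' | exists b].
Qed.

(* The translate of [B] by the smaller of two elements of [A] misses the sum of
   the larger one and [max B]. *)
Lemma ltn_card_sumset (A B : {fset nat}) :
  1 < #|` A| -> B != fset0 -> #|` B| < #|` sumset A B|.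
Proof.
move=> A_gt1 /fset0Pn[b0 b0B].
have [a1 [a2 [a1A a2A lt12]]] : exists a1 a2, [/\ a1 \in A, a2 \in A & a1 < a2].
  have /fset0Pn[a aA] : A != fset0 by rewrite -cardfs_gt0; apply: ltnW.
  have /fset0Pn[b] : (A `\ a)%fset != fset0.
    by rewrite -cardfs_gt0; move: A_gt1; rewrite (cardfsD1 a A) aA.
  rewrite in_fsetD1 => /andP[neq_ba bA].
  have [lt_ab|lt_ba|eq_ab] := ltngtP a b; [by exists a, b | by exists b, a |].
  by rewrite eq_ab eqxx in neq_ba.
pose i0 : B := [` b0B]%fset.
case: (arg_maxnP (fun i : B => val i) (erefl : xpredT i0)) => i _ imax.
rewrite -(card_sumset1 a1 B); apply: fproper_ltn_card.
rewrite fproperE sumsetS ?fsub1set //=; apply/fsubsetP => /(_ (a2 + val i)).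
case/(_ _)/sumsetP.
  by apply/sumsetP; exists a2 => //; exists (val i) => //; apply: valP.
move=> a /fset1P -> [b bB eq_ab].
have le_bi : b <= val i by apply: (imax [` bB]%fset).
by lia.
Qed.

Lemma card_sumset_max (A B : {fset nat}) :
  A != fset0 -> B != fset0 -> #|` sumset A B| = maxn #|` A| #|` B| ->
  #|` A| = 1 \/ #|` B| = 1.
Proof.
move=> A0 B0 eqAB.
have [A_le1|A_gt1] := leqP #|` A| 1.
  by left; apply/eqP; rewrite eqn_leq A_le1 cardfs_gt0.
have [B_le1|B_gt1] := leqP #|` B| 1.
  by right; apply/eqP; rewrite eqn_leq B_le1 cardfs_gt0.
have := ltn_card_sumset A_gt1 B0; have := ltn_card_sumset B_gt1 A0.
by rewrite (sumsetC B) eqAB; lia.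
Qed.

(** * Labels at the two ends of an edge in a weak IASI *)

Section WeakIasi.

Variables (G : sgraph) (f : G -> {fset nat}).
Hypothesis weak_f : weak_iasi f.

(** An empty label at [u] makes the sumset empty, so the maximum forces the label of [v] to be empty
    too, against injectivity of [f]. *)
Lemma weak_iasi_neq0 (u v : G) : adj u v -> f u != fset0.
Proof.
case: weak_f => -[f_inj _] f_max uv; apply/eqP => fu0.
have := f_max _ _ uv; rewrite /induced sumsetC fu0 sumset0 cardfs0 max0n.
move=> /esym/cardfs0_eq fv0.
have eq_uv : u = v by apply: f_inj; rewrite fu0 fv0.
by rewrite eq_uv adj_irrefl in uv.
Qed.

Lemma weak_iasi_mono (u v : G) :
  adj u v -> #|` f u| = 1 \/ #|` f v| = 1.
Proof.
move=> uv; apply: card_sumset_max; last by case: weak_f => _; apply.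
  exact: weak_iasi_neq0 uv.
by apply: (@weak_iasi_neq0 _ u); rewrite adj_sym.
Qed.

Lemma mono_edgeE (u v : G) : adj u v ->
  (#|` induced f u v| == 1) = (#|` f u| == 1) && (#|` f v| == 1).
Proof.
move=> uv; have vu : adj v u by rewrite adj_sym.
case: weak_f => _ ->//.
have := weak_iasi_neq0 uv; have := weak_iasi_neq0 vu.
by rewrite -!cardfs_gt0; lia.
Qed.

End WeakIasi.

(** * Lower bound, by counting mono-indexed edges block by block *)

Section CoronaComplete.

Variables (G : sgraph) (n : nat).

Notation H := (corona G (complete_graph n)).

Definition corona_base (v : H) : G :=
  match v with inl x => x | inr p => p.1 end.

Definition block (x : G) : {set H} := [set v | corona_base v == x].

Lemma corona_adj_block (u v : H) :
  corona_base u = corona_base v -> adj u v = (u != v).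
Proof.
case: u v => [x|[x a]] [y|[y b]] /= ->; rewrite ?eqxx ?adj_irrefl //=.
have inrE (p q : G * complete_graph n) : (inr p == inr q :> H) = (p == q) by [].
by rewrite inrE xpair_eqE eqxx.
Qed.

Lemma card_block (x : G) : #|block x| = n.+1.
Proof.
pose h (o : option 'I_n) : H := if o is Some a then inr (x, a) else inl x.
have h_inj : injective h by case=> [a|] [b|] //= [->].
have <- : #|[set: option 'I_n]| = n.+1 by rewrite cardsT card_option card_ord.
rewrite -(card_imset _ h_inj); apply: eq_card => v; rewrite inE; apply/eqP/imsetP.
  by case: v => [y|[y a]] /= ->; [exists None | exists (Some a)]; rewrite ?in_setT.
by case=> -[a|] _ ->.
Qed.

(** A block is a clique, so these pairs are exactly the edges of the block with both ends in [S]. *)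
Definition block_pairs (S : {set H}) (x : G) : {set {set H}} :=
  [set A : {set H} | (A \subset S :&: block x) && (#|A| == 2)].

(** Blocks are disjoint, so no pair lies in two of them and the counts add up. *)
Lemma card_bigcup_block_pairs (S : {set H}) :
  #|\bigcup_x block_pairs S x| = \sum_x 'C(#|S :&: block x|, 2).
Proof.
rewrite -sum1_card partition_disjoint_bigcup.
  by apply: eq_bigr => x _; rewrite sum1_card cards_draws.
move=> x y neq_xy; rewrite -setI_eq0 -subset0; apply/subsetP => A.
rewrite !inE => /andP[/andP[/subsetP sx cardA] /andP[/subsetP sy _]].
have /cards2P[u [v [_ eqA]]] := cardA.
have uA : u \in A by rewrite eqA set21.
move: (sx u uA) (sy u uA); rewrite !inE => /andP[_ /eqP ->] /andP[_ eq_xy].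
by rewrite eq_xy in neq_xy.
Qed.

Definition mono_verts (f : H -> {fset nat}) : {set H} :=
  [set v | #|` f v| == 1].

Lemma block_pairs_mono (f : H -> {fset nat}) :
  weak_iasi f -> \bigcup_x block_pairs (mono_verts f) x \subset mono_edges f.
Proof.
move=> weak_f; apply/bigcupsP => x _; apply/subsetP => A.
rewrite inE => /andP[/subsetP sA /cards2P[u [v [neq_uv eqA]]]].
have := sA u; have := sA v; rewrite eqA set21 set22 !inE.
move=> /(_ isT) /andP[fv /eqP vx] /(_ isT) /andP[fu /eqP ux].
have uv : adj u v by rewrite corona_adj_block ?ux.
apply/imsetP; exists (u, v) => //; rewrite inE; apply/andP; split=> //.
by rewrite (mono_edgeE weak_f uv) fu fv.
Qed.

Lemma leq_card_mono_block (f : H -> {fset nat}) (x : G) :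
  weak_iasi f -> n <= #|mono_verts f :&: block x|.
Proof.
move=> weak_f.
(* Two vertices of the block with non-singleton labels would be adjacent. *)
suff : #|block x :\: mono_verts f| <= 1.
  by have := cardsID (mono_verts f) (block x); rewrite card_block setIC; lia.
apply/card_le1P => u; rewrite !inE => /andP[fu /eqP ux] v; rewrite !inE.
apply/idP/idP => [/andP[fv /eqP vx]|/eqP ->]; last by rewrite fu ux eqxx.
apply/negPn/negP; rewrite eq_sym -corona_adj_block ?ux // => uv.
by case: (weak_iasi_mono weak_f uv) fu fv => ->.
Qed.

Lemma leq_card_mono_edges (f : H -> {fset nat}) :
  weak_iasi f -> #|G| * 'C(n, 2) <= #|mono_edges f|.
Proof.
move=> weak_f.
apply: leq_trans (subset_leq_card (block_pairs_mono weak_f)).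
rewrite card_bigcup_block_pairs -sum_nat_const.
by apply: leq_sum => x _; apply/leq_bin2l/leq_card_mono_block.
Qed.

End CoronaComplete.

(** * Labels built on powers of 2 *)

Lemma trunc_log_add_expn2 (i j : nat) :
  i != j -> trunc_log 2 (2 ^ i + 2 ^ j) = maxn i j.
Proof.
wlog lt_ij : i j / i < j => [wlog_ij|_].
  case: (ltngtP i j) => // [lt_ij|lt_ji] _.
    by rewrite wlog_ij // ?ltn_eqF //; lia.
  by rewrite addnC wlog_ij // ?ltn_eqF //; lia.
rewrite (maxn_idPr (ltnW lt_ij)); apply: trunc_log_eq => //.
have : 2 ^ i < 2 ^ j by rewrite ltn_exp2l.
by rewrite expnS; lia.
Qed.

(** The sum determines its larger exponent through the logarithm; cancelling that power leaves a
    single power on each side. *)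
Lemma add_expn2_inj (i j k l : nat) :
  i != j -> k != l -> 2 ^ i + 2 ^ j = 2 ^ k + 2 ^ l ->
  (i = k /\ j = l) \/ (i = l /\ j = k).
Proof.
move=> ij kl eq_sum.
have eq_max : maxn i j = maxn k l.
  by rewrite -!trunc_log_add_expn2 // eq_sum.
have expI a b : 2 ^ a = 2 ^ b -> a = b by apply: expnI.
have [|||] : [\/ i = k, i = l, j = k | j = l].
- have : (i = k \/ i = l) \/ (j = k \/ j = l) by lia.
  by case=> -[]; [constructor 1|constructor 2|constructor 3|constructor 4].
- by move=> eq_ik; left; split=> //; apply: expI; move: eq_sum; rewrite eq_ik; lia.
- by move=> eq_il; right; split=> //; apply: expI; move: eq_sum; rewrite eq_il; lia.
- by move=> eq_jk; right; split=> //; apply: expI; move: eq_sum; rewrite eq_jk; lia.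
- by move=> eq_jl; left; split=> //; apply: expI; move: eq_sum; rewrite eq_jl; lia.
Qed.

Section PowerLabels.

Variables (G : sgraph) (S : {set G}).

(** [S] is the set of vertices to be mono-indexed. Labels may overlap, as [{1, 2}] and [{2, 3}] do;
    only their minima, distinct powers of 2, are used to tell them apart. *)
Definition power_label (v : G) : {fset nat} :=
  if v \in S then [fset 2 ^ enum_rank v]%fset
  else [fset 2 ^ enum_rank v; (2 ^ enum_rank v).+1]%fset.

Lemma power_label_min (v : G) : 2 ^ enum_rank v \in power_label v.
Proof. by rewrite /power_label; case: ifP; rewrite !inE eqxx. Qed.

Lemma power_label_ge (v : G) (x : nat) :
  x \in power_label v -> 2 ^ enum_rank v <= x.
Proof.
rewrite /power_label; case: ifP => _; rewrite !inE; first by move/eqP ->.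
by case/orP=> /eqP ->.
Qed.

Lemma card_power_label (v : G) : #|` power_label v| = if v \in S then 1 else 2.
Proof.
rewrite /power_label; case: ifP => _; first by rewrite cardfs1.
by rewrite cardfs2 neq_ltn ltnSn.
Qed.

Lemma power_label_inj : injective power_label.
Proof.
move=> u v eq_uv; apply/enum_rank_inj/val_inj/(@expnI 2) => //=.
apply/eqP; rewrite eqn_leq !power_label_ge //.
  by rewrite -eq_uv power_label_min.
by rewrite eq_uv power_label_min.
Qed.

(** The least element of a sumset is the sum of the two minima. Used in both directions, this gives
    equality. *)
Lemma induced_power_label_le (u v u' v' : G) :
  induced power_label u v = induced power_label u' v' ->
  2 ^ enum_rank u' + 2 ^ enum_rank v' <= 2 ^ enum_rank u + 2 ^ enum_rank v.
Proof.
move=> eq_uv.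
have : 2 ^ enum_rank u + 2 ^ enum_rank v \in induced power_label u' v'.
  rewrite -eq_uv; apply/sumsetP.
  by exists (2 ^ enum_rank u); [|exists (2 ^ enum_rank v)];
    rewrite ?power_label_min.
by case/sumsetP => a /power_label_ge ha [b /power_label_ge hb ->]; lia.
Qed.

(** As [S] is a vertex cover, each edge has an end with a singleton label, and its sumset is a
    translate of the other label. *)
Lemma power_label_weak_iasi :
  (forall u v : G, adj u v -> (u \in S) || (v \in S)) -> weak_iasi power_label.
Proof.
move=> coverS; split; first split; first exact: power_label_inj.
  move=> u v u' v' uv uv' eq_uv.
  have neq_rank (x y : G) : adj x y -> enum_rank x != enum_rank y :> nat.
    move=> xy; apply/eqP => /val_inj/enum_rank_inj eq_xy.
    by rewrite eq_xy adj_irrefl in xy.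
  have eq_sum : 2 ^ enum_rank u + 2 ^ enum_rank v
              = 2 ^ enum_rank u' + 2 ^ enum_rank v'.
    by apply/eqP; rewrite eqn_leq !induced_power_label_le.
  case: (add_expn2_inj (neq_rank _ _ uv) (neq_rank _ _ uv') eq_sum) => -[];
    move=> /val_inj/enum_rank_inj -> /val_inj/enum_rank_inj -> //.
  by rewrite setUC.
have mono u v : u \in S ->
    #|` induced power_label u v| = maxn #|` power_label u| #|` power_label v|.
  move=> uS; rewrite /induced (card_power_label u) uS {1}/power_label uS.
  by rewrite card_sumset1 card_power_label; case: ifP.
move=> u v /coverS /orP[uS|vS]; first exact: mono.
by rewrite /induced sumsetC maxnC; apply: mono.
Qed.

End PowerLabels.

(** * Attaining the bound over a 2-coloured graph, then over the path *)

Lemma sparing_number_corona_complete (G : sgraph) (c : G -> bool) (n : nat) :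
  0 < n -> (forall x y : G, adj x y -> c x != c y) ->
  is_sparing_number (corona G (complete_graph n)) (#|G| * 'C(n, 2)).
Proof.
move=> n_gt0 c_proper; split; last exact: leq_card_mono_edges.
pose H := corona G (complete_graph n).
(* [d x] is the one vertex of the block of [x] that gets a doubleton. *)
pose d (x : G) : H := if c x then inl x else inr (x, Ordinal n_gt0).
pose S : {set H} := [set v | v != d (corona_base v)].
have base_d x : corona_base (d x) = x by rewrite /d; case: (c x).
(* Edges between blocks join vertices of [G]; if both ends were values of [d], they would have the
   same colour. *)
have coverS (u v : H) : adj u v -> (u \in S) || (v \in S).
  move=> uv; rewrite !inE -negb_and; apply/negP => /andP[/eqP eq_u /eqP eq_v].
  have [eq_base|neq_base] := eqVneq (corona_base u) (corona_base v).
    by move: uv; rewrite eq_u eq_v eq_base adj_irrefl.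
  move: uv; rewrite eq_u eq_v /d.
  case cu: (c _); case cv: (c _) => /= uv.
  - by have := c_proper _ _ uv; rewrite cu cv.
  - by rewrite uv in neq_base.
  - by rewrite eq_sym uv in neq_base.
  - by case/andP: uv => uv _; rewrite uv in neq_base.
have weak_f := power_label_weak_iasi coverS.
have monoS : mono_verts (power_label S) = S.
  by apply/setP => v; rewrite inE card_power_label; case: (v \in S).
exists (power_label S); split=> //.
(* Of two adjacent vertices of [G], one has colour [true] and so lies outside [S]; hence a
   mono-indexed edge stays within a block. *)
have -> : mono_edges (power_label S) = \bigcup_x block_pairs S x.
  apply/eqP; rewrite eqEsubset -{3}monoS block_pairs_mono // andbT.
  apply/subsetP => A /imsetP[[u v]]; rewrite inE /= => /andP[uv].
  rewrite mono_edgeE // => /andP[fu fv] ->.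
  have uS : u \in S by rewrite -monoS inE.
  have vS : v \in S by rewrite -monoS inE.
  have eq_base : corona_base v = corona_base u.
    move: uv uS vS; rewrite !inE.
    case: u v {fu fv} => [x|[x a]] [y|[y b]] /=.
    - move=> /c_proper; rewrite /d.
      by case: (c x); case: (c y) => //=; rewrite eqxx.
    - by move/eqP.
    - by move/eqP.
    - by case/andP => /eqP.
  have neq_uv : u != v by rewrite -corona_adj_block.
  apply/bigcupP; exists (corona_base u) => //.
  rewrite inE cards2 neq_uv andbT; apply/subsetP => w.
  by case/set2P => ->; rewrite in_setI ?uS ?vS inE ?eq_base eqxx.
rewrite card_bigcup_block_pairs -sum_nat_const; apply: eq_bigr => x _.
suff -> : S :&: block n x = block n x :\ d x.
  have := cardsD1 (d x) (block n x).
  by rewrite card_block inE base_d eqxx add1n => -[<-].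
apply/setP => v; rewrite !inE.
by have [->|_] := eqVneq (corona_base v) x; rewrite ?andbT ?andbF.
Qed.

Theorem theorem2p9 (m n : nat) (hm : 1 <= m) (hn : 2 <= n) :
  is_sparing_number (corona (path_graph m) (complete_graph n))
    ((n * (n - 1) * (m + 1)) %/ 2).
Proof.
have -> : (n * (n - 1) * (m + 1)) %/ 2 = #|path_graph m| * 'C(n, 2).
  rewrite card_ord bin2 subn1 addn1 mulnC divn2.
  (* The truncated halving is exact, since one of two consecutive integers is even. *)
  have -> : n * n.-1 = 2 * (n * n.-1)./2.
    by rewrite mul2n halfK; case: n {hn} => // k; rewrite /= oddM /= andNb subn0.
  by rewrite mulnCA mul2n doubleK mul2n doubleK.
apply: (@sparing_number_corona_complete (path_graph m) (fun i => odd (i : 'I_m.+1))).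
  exact: ltnW.
(* Consecutive positions on the path have opposite parity. *)
by move=> x y /orP[] /eqP <- /=; case: odd.
Qed.
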